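(* Let $\mathbf{k}$ be a field of characteristic zero and $\lambda\in\mathbf{k}$ nonzero. Let $R$ be a modified Rota-Baxter operator of weight $\lambda$ on a Lie algebra $(\mathfrak{g},[\cdot,\cdot])$ over $\mathbf{k}$, and let $f\in\mathfrak{g}^*$ satisfy $f([x,y])=0$ for all $x,y\in\mathfrak{g}$. Let $[x,y,z]_f=f(x)[y,z]+f(y)[z,x]+f(z)[x,y]$ be the induced $3$-Lie bracket on $\mathfrak{g}$. Then $R$ is a modified Rota-Baxter operator of weight $\lambda$ on the $3$-Lie algebra $(\mathfrak{g},[\cdot,\cdot,\cdot]_f)$ if and only if for all $x,y,z\in\mathfrak{g}$ \begin{align*} &R\Big(f(x)[Ry,Rz]+f(y)[Rz,Rx]+f(z)[Rx,Ry]+\lambda f(x)[y,z]+\lambda f(y)[z,x]+\lambda f(z)[x,y]\Big)\\ &-\lambda f(x)[Ry,z]-\lambda f(x)[y,Rz]-\lambda f(y)[Rz,x]-\lambda f(y)[z,Rx]-\lambda f(z)[Rx,y]-\lambda f(z)[x,Ry]\\ &-2\lambda f(Rx)[y,z]-2\lambda f(Ry)[z,x]-2\lambda f(Rz)[x,y]=0. \end{align*}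
   Context: A modified Rota-Baxter operator of weight $\lambda$ on a Lie algebra $(\mathfrak{g},[\cdot,\cdot])$ is a linear map $R:\mathfrak{g}\to\mathfrak{g}$ with $[Rx,Ry]=R([Rx,y]+[x,Ry])+\lambda[x,y]$ for all $x,y$. A $3$-Lie algebra is a vector space with a skew-symmetric trilinear bracket satisfying $[x,y,[u,v,w]]=[[x,y,u],v,w]+[u,[x,y,v],w]+[u,v,[x,y,w]]$. It is known that $[\cdot,\cdot,\cdot]_f$ is a $3$-Lie bracket when $f$ vanishes on $[\mathfrak{g},\mathfrak{g}]$. A modified Rota-Baxter operator of weight $\lambda$ on a $3$-Lie algebra $(\mathfrak{g},[\cdot,\cdot,\cdot])$ is a linear map $R:\mathfrak{g}\to\mathfrak{g}$ such that for all $x,y,z$ $$[Rx,Ry,Rz]=R\big([Rx,Ry,z]+[x,Ry,Rz]+[Rx,y,Rz]+\lambda[x,y,z]\big)-\lambda[Rx,y,z]-\lambda[x,Ry,z]-\lambda[x,y,Rz].$$ *)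

(* Defs.v *)
From mathcomp Require Import all_boot all_order all_algebra.

Set Implicit Arguments.
Unset Strict Implicit.
Unset Printing Implicit Defensive.

Import GRing.Theory.

Local Open Scope ring_scope.

(* Brackets are bundled as data on a fixed vector space, not as canonical
   structures, because one space carries a Lie bracket and a 3-Lie bracket. *)
Record lie_bracket (k : fieldType) (g : lmodType k) := LieBracket {
  lie_br :> g -> g -> g;
  lie_linearl : forall y, linear (fun x => lie_br x y);
  lie_linearr : forall x, linear (lie_br x);
  lie_alt : forall x, lie_br x x = 0;
  lie_jacobi : forall x y z,
    lie_br x (lie_br y z) + lie_br y (lie_br z x) + lie_br z (lie_br x y) = 0
}.

(* Skew-symmetry is given on the two adjacent transpositions, which generate
   the symmetric group on the three arguments. *)
Record lie3_bracket (k : fieldType) (g : lmodType k) := Lie3Bracket {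
  lie3_br :> g -> g -> g -> g;
  lie3_linear1 : forall y z, linear (fun x => lie3_br x y z);
  lie3_linear2 : forall x z, linear (fun y => lie3_br x y z);
  lie3_linear3 : forall x y, linear (lie3_br x y);
  lie3_skew12 : forall x y z, lie3_br y x z = - lie3_br x y z;
  lie3_skew23 : forall x y z, lie3_br x z y = - lie3_br x y z;
  lie3_fundamental : forall x y u v w,
    lie3_br x y (lie3_br u v w) =
      lie3_br (lie3_br x y u) v w + lie3_br u (lie3_br x y v) w
      + lie3_br u v (lie3_br x y w)
}.

Definition modified_RB_lie (k : fieldType) (g : lmodType k)
    (L : lie_bracket g) (lam : k) (R : {linear g -> g}) : Prop :=
  forall x y : g,
    L (R x) (R y) = R (L (R x) y + L x (R y)) + lam *: L x y.

Definition modified_RB_lie3 (k : fieldType) (g : lmodType k)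
    (T : lie3_bracket g) (lam : k) (R : {linear g -> g}) : Prop :=
  forall x y z : g,
    T (R x) (R y) (R z) =
      R (T (R x) (R y) z + T x (R y) (R z) + T (R x) y (R z)
         + lam *: T x y z)
      - lam *: T (R x) y z - lam *: T x (R y) z - lam *: T x y (R z).

Section InducedBracket.

Variables (k : fieldType) (g : lmodType k) (L : lie_bracket g).
Variable f : {scalar g}.

Definition induced_br (x y z : g) : g :=
  f x *: L y z + f y *: L z x + f z *: L x y.

Hypothesis fL : forall x y : g, f (L x y) = 0.

Let LDl x y z : L (x + y) z = L x z + L y z.
Proof. by have := lie_linearl L z 1 x y; rewrite !scale1r. Qed.

Let LDr x y z : L z (x + y) = L z x + L z y.
Proof. by have := lie_linearr L z 1 x y; rewrite !scale1r. Qed.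

Let L0l z : L 0 z = 0.
Proof. by apply: (addrI (L 0 z)); rewrite -LDl !addr0. Qed.

Let L0r z : L z 0 = 0.
Proof. by apply: (addrI (L z 0)); rewrite -LDr !addr0. Qed.

Let LZl a x z : L (a *: x) z = a *: L x z.
Proof. by have := lie_linearl L z a x 0; rewrite /= L0l !addr0. Qed.

Let LZr a x z : L z (a *: x) = a *: L z x.
Proof. by have := lie_linearr L z a x 0; rewrite L0r !addr0. Qed.

Let LC x y : L x y = - L y x.
Proof.
apply/eqP; rewrite -addr_eq0; apply/eqP.
by have := lie_alt L (x + y); rewrite LDl !LDr !lie_alt add0r addr0.
Qed.

Let LNr x y : L x (- y) = - L x y.
Proof. by rewrite -scaleN1r LZr scaleN1r. Qed.

Let leibniz x y z : L x (L y z) = L (L x y) z + L y (L x z).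
Proof.
apply/eqP; rewrite -subr_eq0 opprD addrA -(lie_jacobi L x y z).
rewrite (LC (L x y)) opprK (LC z x) LNr.
by rewrite addrAC.
Qed.

Let D x y z := f x *: L y z - f y *: L x z.

Let induced_brE x y z : induced_br x y z = D x y z + f z *: L x y.
Proof. by rewrite /induced_br /D (LC z x) scalerN. Qed.

Let f_D x y z : f (D x y z) = 0.
Proof. by rewrite /D linearB !linearZ /= !fL !mulr0 subr0. Qed.

Let f_induced x y z : f (induced_br x y z) = 0.
Proof.
by rewrite induced_brE linearD linearZ /= f_D fL mulr0 addr0.
Qed.

Let DD x y u v : D x y (u + v) = D x y u + D x y v.
Proof. by rewrite /D !LDr !scalerDr opprD addrACA. Qed.

Let DZ x y a u : D x y (a *: u) = a *: D x y u.
Proof. by rewrite /D !LZr scalerBr !scalerA ![_ * a]mulrC. Qed.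

Let D_deriv x y u v : D x y (L u v) = L (D x y u) v + L u (D x y v).
Proof.
rewrite /D (leibniz y) (leibniz x) -!scaleNr LDl LDr !LZl !LZr !scalerDr.
by rewrite addrACA.
Qed.

Let induced_cycle x y z : induced_br x y z = induced_br y z x.
Proof. by rewrite /induced_br -[LHS]addrA addrC. Qed.

Lemma induced_linear3 x y : linear (induced_br x y).
Proof.
move=> a u v; rewrite !induced_brE DD DZ linearP /= scalerDl -scalerA.
by rewrite [a *: (D x y u + _)]scalerDr addrACA.
Qed.

Lemma induced_linear1 y z : linear (fun x => induced_br x y z).
Proof.
by move=> a u v; rewrite /= !(induced_cycle _ y z); apply: induced_linear3.
Qed.

Lemma induced_linear2 x z : linear (fun y => induced_br x y z).
Proof.
move=> a u v; rewrite /= -!(induced_cycle z x).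
exact: induced_linear3.
Qed.

Lemma induced_skew12 x y z : induced_br y x z = - induced_br x y z.
Proof.
rewrite /induced_br (LC x z) (LC z y) (LC y x) !scalerN -!opprD.
by rewrite [f y *: _ + _]addrC.
Qed.

Lemma induced_skew23 x y z : induced_br x z y = - induced_br x y z.
Proof. by rewrite !(induced_cycle x) induced_skew12. Qed.

(* [z |-> induced_br x y z] is the derivation [D x y] plus [f z *: L x y];
   the contributions of the second summand cancel pairwise. *)
Lemma induced_fundamental x y u v w :
  induced_br x y (induced_br u v w) =
    induced_br (induced_br x y u) v w + induced_br u (induced_br x y v) w
    + induced_br u v (induced_br x y w).
Proof.
rewrite induced_brE f_induced scale0r addr0.
have E a b c : induced_br a b (induced_br x y c)
    = f a *: L b (D x y c) + f b *: L (D x y c) a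
      + ((f c * f a) *: L b (L x y) - (f b * f c) *: L a (L x y)).
  rewrite {1}/induced_br f_induced scale0r addr0 induced_brE.
  rewrite LDl LDr LZl LZr !scalerDr !scalerA (LC (L x y) a) scalerN.
  by rewrite addrACA [f a * _]mulrC.
rewrite (induced_cycle (induced_br x y u)) -(induced_cycle w u (induced_br x y v)) !E.
rewrite /induced_br 2!DD !DZ !D_deriv.
rewrite (scalerDr (f u)) (scalerDr (f v)) (scalerDr (f w)).
move: (D x y u) (D x y v) (D x y w) => du dv dw.
set p := (f u * f v) *: _; set q := (f w * f u) *: _.
set r := (f v * f w) *: _.
have pqr0 : p - q + (r - p) + (q - r) = 0.
  by rewrite [p - q + _]addrC -[r - p + _]addrA addKr -[q - r]opprB subrr.
rewrite (addrACA _ (p - q)) (addrACA _ (p - q + _)) pqr0 addr0.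
by rewrite [LHS](AC (2*2*2) ((4*5)*(6*1)*(2*3))).
Qed.

Definition induced_lie3 : lie3_bracket g :=
  Lie3Bracket induced_linear1 induced_linear2 induced_linear3
    induced_skew12 induced_skew23 induced_fundamental.

End InducedBracket.

(* Main.v *)
Require Import Defs.
From mathcomp Require Import all_boot all_order all_algebra.

Import GRing.Theory.

Local Open Scope ring_scope.

(* The defect of [R] as an operator on the induced 3-Lie algebra equals the
   left-hand side of the criterion: modulo cyclic permutations of [x, y, z],
   the terms weighted by [f (R x)] combine into
   [f (R x) *: (R ([R y, z] + [y, R z]) - [R y, R z])], which the operator
   identity on the Lie algebra turns into [- lam f (R x) [y, z]]. *)

Section InducedDefect.

Variables (k : fieldType) (g : lmodType k) (L : lie_bracket g).
Variables (lam : k) (R : {linear g -> g}) (f : {scalar g}).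

(** [C], [B] and [A] carry [R] on no, one and both arguments of the bracket. The criterion is a
    combination of the sums [cyc] with weights [f] or [f \o R], and [cyc f C] is the induced
    bracket. *)
Let C y z := L y z.
Let B y z := L (R y) z + L y (R z).
Let A y z := L (R y) (R z).
Let cyc (h : g -> k) (b : g -> g -> g) x y z :=
  h x *: b y z + h y *: b z x + h z *: b x y.

(** When [f] takes the argument free of [R], both bracket entries are images, which gives [A]; the
    six other terms have a weight [f (R _)] and pair up into [B]. *)
Lemma induced_br_two_images x y z :
  induced_br L f (R x) (R y) z + induced_br L f x (R y) (R z)
    + induced_br L f (R x) y (R z) = cyc f A x y z + cyc (f \o R) B x y z.
Proof.
rewrite /induced_br /cyc /A /B /= !scalerDr.
by rewrite [LHS](AC (3*3*3) ((4*8*3)*((1*7)*(5*2)*(9*6)))).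
Qed.

Lemma induced_br_one_image x y z :
  induced_br L f (R x) y z + induced_br L f x (R y) z
    + induced_br L f x y (R z) = cyc f B x y z + cyc (f \o R) C x y z.
Proof.
rewrite /induced_br /cyc /C /B /= !scalerDr.
by rewrite [LHS](AC (3*3*3) (((4*7)*(8*2)*(3*6))*(1*5*9))).
Qed.

(** The left side is [cyc (f \o R) A], and [hR] turns each [A] into [R B + lam C]. *)
Lemma induced_br_three_images (hR : modified_RB_lie L lam R) x y z :
  induced_br L f (R x) (R y) (R z) =
    R (cyc (f \o R) B x y z) + lam *: cyc (f \o R) C x y z.
Proof.
rewrite /induced_br /cyc /B /C /= !hR !linearD !linearZ /=.
rewrite !scalerA ![lam * _]mulrC.
by rewrite [LHS](AC (3*3*3) (((1*2)*(4*5)*(7*8))*(3*6*9))).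
Qed.

Lemma induced_defectE (hR : modified_RB_lie L lam R) x y z :
  R (induced_br L f (R x) (R y) z + induced_br L f x (R y) (R z)
     + induced_br L f (R x) y (R z) + lam *: induced_br L f x y z)
  - lam *: induced_br L f (R x) y z - lam *: induced_br L f x (R y) z
  - lam *: induced_br L f x y (R z) - induced_br L f (R x) (R y) (R z) =
  R (f x *: L (R y) (R z) + f y *: L (R z) (R x) + f z *: L (R x) (R y)
     + (lam * f x) *: L y z + (lam * f y) *: L z x + (lam * f z) *: L x y)
  - (lam * f x) *: L (R y) z - (lam * f x) *: L y (R z)
  - (lam * f y) *: L (R z) x - (lam * f y) *: L z (R x)
  - (lam * f z) *: L (R x) y - (lam * f z) *: L x (R y)
  - (2%:R * lam * f (R x)) *: L y z
  - (2%:R * lam * f (R y)) *: L z x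
  - (2%:R * lam * f (R z)) *: L x y.
Proof.
have -> : f x *: L (R y) (R z) + f y *: L (R z) (R x) + f z *: L (R x) (R y)
    + (lam * f x) *: L y z + (lam * f y) *: L z x + (lam * f z) *: L x y
    = cyc f A x y z + lam *: induced_br L f x y z.
  by rewrite /cyc /A /induced_br !scalerDr !scalerA !addrA.
set c := R (_ + _ + lam *: _); set d := R (_ + lam *: _).
(* The middle term is the criterion with its cyclic sums collected. *)
transitivity (d - lam *: cyc f B x y z
    - (2%:R * lam) *: cyc (f \o R) C x y z); last first.
  by rewrite /cyc /B /C /= !scalerDr !scalerA !opprD !addrA.
have -> : c = d + R (cyc (f \o R) B x y z).
  by rewrite /c /d induced_br_two_images -linearD addrAC.
rewrite (induced_br_three_images hR) -!(addrA _ (- (lam *: _))) -!opprD.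
rewrite !addrA -!scalerDr induced_br_one_image.
(* The factor 2 counts one [lam *: cyc (f \o R) C] from the one-image terms and one from the bracket
   of three images; the two terms [R (cyc (f \o R) B)] cancel. *)
rewrite mulr_natl mulr2n scalerDl scalerDr !opprD !addrA.
by rewrite [LHS](AC 6 ((1*3*4*6)*(2*5))) /= subrr addr0.
Qed.

End InducedDefect.

Theorem theorem4p3 (k : fieldType) (char0 : [pchar k] =i pred0)
    (lam : k) (lam_neq0 : lam != 0) (g : lmodType k) (L : lie_bracket g)
    (R : {linear g -> g}) (hR : modified_RB_lie L lam R)
    (f : {scalar g}) (fL : forall x y : g, f (L x y) = 0) :
  modified_RB_lie3 (induced_lie3 fL) lam R <->
  (forall x y z : g,
     R (f x *: L (R y) (R z) + f y *: L (R z) (R x) + f z *: L (R x) (R y)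
        + (lam * f x) *: L y z + (lam * f y) *: L z x + (lam * f z) *: L x y)
     - (lam * f x) *: L (R y) z - (lam * f x) *: L y (R z)
     - (lam * f y) *: L (R z) x - (lam * f y) *: L z (R x)
     - (lam * f z) *: L (R x) y - (lam * f z) *: L x (R y)
     - (2%:R * lam * f (R x)) *: L y z
     - (2%:R * lam * f (R y)) *: L z x
     - (2%:R * lam * f (R z)) *: L x y = 0).
Proof.
(* Both conditions say that the defect, right side minus left side of the 3-Lie identity, is
   zero. *)
split=> [H x y z | H x y z].
  by rewrite -induced_defectE //; apply/eqP; rewrite subr_eq0; apply/eqP/esym/H.
by apply/esym/eqP; rewrite -subr_eq0; apply/eqP; rewrite [LHS]induced_defectE.
Qed.
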